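(* For $\alpha\in(0,1)$, the class $\mathcal I_\alpha$ of $\alpha$-prediction intervals is not selectively elicitable on $\mathcal M_{\alpha,\mathrm{inc}}$.
   Context: $\mathcal M_0$ is the class of Borel probability distributions on $\mathbb R$; $\bar{\mathbb R}=\mathbb R\cup\{-\infty,\infty\}$, $\bar U=\{(a,b)^\top\in\bar{\mathbb R}^2:a\le b\}$. For $(a,b)^\top\in\bar U$ put $F([a,b])=F([a,b]\cap\mathbb R)$; $F(a-)=F((-\infty,a))$. $\mathcal I_\alpha(F)=\{(a,b)^\top\in\bar U:F([a,b])\ge\alpha\}\subseteq\bar U$. Quantiles: $q_\beta(F)=\{t\in\bar{\mathbb R}:F((-\infty,t))\le\beta\le F((-\infty,t])\}$. $F\in\mathcal M_{\alpha,\mathrm{inc}}$ iff $F\in\mathcal M_0$, $q_\alpha(F)$ and $q_{1-\alpha}(F)$ are singletons, and for all $a\in\mathbb R$ with $F(a-)<1-\alpha$: if $q_{\alpha+F(a-)}(F)$ has more than one element then $q_{F(a-)}(F)=\{a\}$. $\mathcal I_\alpha$ is selectively elicitable on $\mathcal M$ if there is $S\colon\bar U\times\mathbb R\to(-\infty,\infty]$ whose expectations $\bar S(x,F)=\int S(x,y)\,dF(y)$ exist and satisfy $\bar S(x,F)<\infty$ for all $x\in\bar U$, $F\in\mathcal M$, such that $\bar S(t,F)\le\bar S(x,F)$ for all $x\in\bar U$, $t\in\mathcal I_\alpha(F)$, $F\in\mathcal M$, with equality only if $x\in\mathcal I_\alpha(F)$. *)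

(* Defs.v *)
From HB Require Import structures.
From mathcomp Require Import all_boot all_order all_algebra.
From mathcomp Require Import all_classical all_reals all_analysis.
From mathcomp Require Import measurable_realfun.
Import Order.TTheory GRing.Theory Num.Theory.
Import numFieldNormedType.Exports.

Set Implicit Arguments.
Unset Strict Implicit.
Unset Printing Implicit Defensive.

Local Open Scope classical_set_scope.
Local Open Scope ring_scope.
Local Open Scope ereal_scope.

Definition distr (R : realType) := probability (measurableTypeR R) R.

Definition Ubar (R : realType) := {x : \bar R * \bar R | x.1 <= x.2}.

(* The interval [a, b] of extended reals, intersected with the real line. *)
Definition real_itv (R : realType) (x : Ubar R) : set R :=
  [set y : R | (val x).1 <= y%:E <= (val x).2].

Definition pred_intervals (R : realType) (alpha : R) (F : distr R) :
    set (Ubar R) :=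
  [set x | alpha%:E <= F (real_itv x)].

(* The level is extended-real because it is applied to values of F; these are
   finite. For t = -oo both half-lines are empty, for t = +oo both are R. *)
Definition quantiles (R : realType) (beta : \bar R) (F : distr R) :
    set (\bar R) :=
  [set t | F [set y : R | y%:E < t] <= beta <= F [set y : R | y%:E <= t]].

Definition left_cdf (R : realType) (F : distr R) (a : R) : \bar R :=
  F [set y : R | (y < a)%R].

Definition M_inc (R : realType) (alpha : R) : set (distr R) :=
  [set F |
    (exists t, quantiles alpha%:E F = [set t]) /\
    (exists t, quantiles (1 - alpha)%:E F = [set t]) /\
    (forall a : R, left_cdf F a < (1 - alpha)%:E ->
      (exists s t, quantiles (alpha%:E + left_cdf F a) F s /\
                   quantiles (alpha%:E + left_cdf F a) F t /\ s <> t) ->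
      quantiles (left_cdf F a) F = [set a%:E])].

(* The integral of the library is total (with +oo - +oo = -oo), so that the
   existence of an expectation in [-oo, +oo] has to be stated separately. *)
Definition expectation_exists (R : realType) (F : distr R)
    (f : measurableTypeR R -> \bar R) : Prop :=
  measurable_fun setT f /\
  (\int[F]_y (f^\+ y) < +oo \/ \int[F]_y (f^\- y) < +oo).

Definition expected_score (R : realType)
    (S : Ubar R -> measurableTypeR R -> \bar R) (x : Ubar R) (F : distr R) :
    \bar R :=
  \int[F]_y S x y.

Definition selectively_elicitable (R : realType)
    (I : distr R -> set (Ubar R)) (M : set (distr R)) : Prop :=
  exists S : Ubar R -> measurableTypeR R -> \bar R,
    (forall x y, -oo < S x y) /\
    (forall x F, M F ->
      expectation_exists F (S x) /\ expected_score S x F < +oo) /\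
    (forall x t F, M F -> I F t ->
      expected_score S t F <= expected_score S x F /\
      (expected_score S t F = expected_score S x F -> I F x)).

(* Main.v *)
From HB Require Import structures.
Require Import Defs.
From mathcomp Require Import all_boot all_order all_algebra.
From mathcomp Require Import all_classical all_reals all_analysis.
From mathcomp Require Import lra measurable_realfun.
Import Order.TTheory GRing.Theory Num.Theory.
Local Open Scope classical_set_scope.
Local Open Scope ring_scope.

(** Point masses, and two-point distributions whose lower atom has mass greater
    than [alpha] and [1 - alpha], lie in the class.  Compare the scores of
    [x = [0, 0]] and of the whole line.  Expectations under point masses are
    just values of the score, so [S x 0 = S line 0] (both intervals are
    admissible for the mass at [0]) and [S line 1 < S x 1] ([x] is not
    admissible for the mass at [1]), all four values being finite.  Mixing the
    two points with a large weight on [0], the expected score of [x] exceeds that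
    of the line, although both intervals are admissible. *)

Section quantiles_at_lowest_atom.
Local Open Scope ereal_scope.

Lemma measurable_EFin_lt (R : realType) (t : \bar R) :
  measurable ([set y : R | y%:E < t] : set (measurableTypeR R)).
Proof.
have := @EFin_measurable R setT measurableT _ (emeasurable_itv `]-oo, t[).
by rewrite setTI; congr measurable; apply/seteqP; split=> y /=; rewrite in_itv.
Qed.

Lemma measurable_EFin_le (R : realType) (t : \bar R) :
  measurable ([set y : R | y%:E <= t] : set (measurableTypeR R)).
Proof.
have := @EFin_measurable R setT measurableT _ (emeasurable_itv `]-oo, t]).
by rewrite setTI; congr measurable; apply/seteqP; split=> y /=; rewrite in_itv.
Qed.

(** A point [t > c] has at least the mass of []-oo, c]], hence more than [beta], strictly to its
    left; a point [t < c] has no mass up to and including [t], hence less than [beta]. Only [c]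
    remains. *)
Lemma quantiles_lowest_atom (R : realType) (F : distr R) (c : R) (beta : \bar R) :
  left_cdf F c = 0 -> 0 < beta -> beta < F [set y : R | (y <= c)%R] ->
  quantiles beta F = [set c%:E].
Proof.
move=> Fc0 beta_gt0 beta_lt; apply/seteqP; split=> t /=; last first.
  move=> ->; apply/andP; split; last exact: ltW.
  by rewrite (_ : F _ = 0) ?ltW.
case/andP=> Flt Fle; apply/eqP; rewrite eq_le; apply/andP; split.
  rewrite leNgt; apply/negP => c_lt_t.
  suff : beta < beta by rewrite ltxx.
  apply: (lt_le_trans beta_lt); apply: le_trans Flt.
  apply: le_measure; rewrite ?inE.
  - exact: (@measurable_EFin_le R c%:E).
  - exact: measurable_EFin_lt.
  - by move=> y /= yc; apply: le_lt_trans c_lt_t; rewrite lee_fin.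
rewrite leNgt; apply/negP => t_lt_c.
suff : beta <= 0 by rewrite leNgt beta_gt0.
apply: (le_trans Fle); rewrite -Fc0; apply: le_measure; rewrite ?inE.
- exact: measurable_EFin_le.
- exact: (@measurable_EFin_lt R c%:E).
- by move=> y /= yt; have := le_lt_trans yt t_lt_c; rewrite lte_fin.
Qed.

(** The two singleton conditions come from [quantiles_lowest_atom]. The third holds vacuously:
    [left_cdf F a < 1 - alpha] forces [a <= c], so [left_cdf F a = 0], and the quantile set in
    question is the one at level [alpha], a singleton. *)
Lemma M_inc_lowest_atom (R : realType) (alpha : R) (F : distr R) (c : R) :
  (0 < alpha < 1)%R -> left_cdf F c = 0 ->
  alpha%:E < F [set y : R | (y <= c)%R] ->
  (1 - alpha)%:E < F [set y : R | (y <= c)%R] ->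
  M_inc alpha F.
Proof.
move=> /andP[a0 a1] Fc0 Fa Fa'.
have qa : quantiles alpha%:E F = [set c%:E] by exact: quantiles_lowest_atom.
split; first by exists c%:E.
split.
  by exists c%:E; apply: quantiles_lowest_atom => //; rewrite lte_fin subr_gt0.
move=> a Flt [s [t [qs [qt st]]]].
have le_ac : (a <= c)%R.
  rewrite leNgt; apply/negP => ca.
  have : F [set y : R | (y <= c)%R] <= left_cdf F a.
    apply: le_measure; rewrite ?inE.
    - exact: (@measurable_EFin_le R c%:E).
    - exact: (@measurable_EFin_lt R a%:E).
    - by move=> y /= yc; exact: le_lt_trans ca.
  by move=> h; have := lt_trans (le_lt_trans h Flt) Fa'; rewrite ltxx.
have Fa0 : left_cdf F a = 0.
  apply/eqP; rewrite eq_le measure_ge0 andbT -Fc0; apply: le_measure; rewrite ?inE.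
  - exact: (@measurable_EFin_lt R a%:E).
  - exact: (@measurable_EFin_lt R c%:E).
  - by move=> y /= ya; exact: lt_le_trans le_ac.
by case: st; move: qs qt; rewrite Fa0 adde0 qa => -> ->.
Qed.

End quantiles_at_lowest_atom.

Definition point_mass {R : realType} (c : R) : distr R :=
  @dirac _ (measurableTypeR R) c R.

Lemma point_massE (R : realType) (c : R) (A : set R) :
  point_mass c A = (c \in A)%:R%:E.
Proof. exact: diracE. Qed.

Section two_point_distribution.
Local Open Scope ereal_scope.
Context {R : realType}.

Definition bool_rv (a b : R) (i : bool) : measurableTypeR R := if i then a else b.

Lemma measurable_bool_rv (a b : R) : measurable_fun setT (bool_rv a b).
Proof. by []. Qed.

HB.instance Definition _ (a b : R) :=
  isMeasurableFun.Build _ _ _ _ (bool_rv a b) (measurable_bool_rv a b).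

(** As the law of a Bernoulli variable this is a probability by construction; the weight [p] sits on
    [a]. *)
Definition two_point (p a b : R) : distr R :=
  distribution (bernoulli_prob p) (bool_rv a b).

Lemma two_pointE (p a b : R) (A : set R) : (0 <= p <= 1)%R ->
  two_point p a b A = p%:E * \d_a A + (1 - p)%:E * \d_b A.
Proof. by move=> p01; rewrite /two_point /= /distribution /pushforward bernoulli_probE. Qed.

(** Positive and negative parts are transferred separately to the Bernoulli space. Finiteness at the
    two atoms rules out [+oo - +oo] and reduces the recombination to real arithmetic, by cases on
    signs. *)
Lemma integral_two_point (p a b : R) (f : measurableTypeR R -> \bar R) :
  (0 <= p <= 1)%R -> measurable_fun setT f ->
  f a \is a fin_num -> f b \is a fin_num ->
  \int[two_point p a b]_y f y = p%:E * f a + (1 - p)%:E * f b.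
Proof.
move=> p01 mf fa fb; rewrite integralE.
rewrite ge0_integral_pushforward//; last exact: measurable_funepos.
rewrite ge0_integral_pushforward//; last exact: measurable_funeneg.
rewrite preimage_setT !integral_bernoulli_prob//=.
rewrite !funeposE !funenegE -(fineK fa) -(fineK fb) -!EFinN -!EFin_max.
rewrite -!EFinM -!EFinD; congr EFin; rewrite /unstable.onem.
by case: (ltrP (fine (f a))); case: (ltrP (fine (f b)));
   case: (ltrP (- fine (f a))); case: (ltrP (- fine (f b))); nra.
Qed.

End two_point_distribution.

Theorem corollary4p7 (R : realType) (alpha : R)
    (alpha_gt0 : 0 < alpha) (alpha_lt1 : alpha < 1) :
  ~ selectively_elicitable (pred_intervals alpha) (M_inc alpha).
Proof.
case=> S [S_gtNy [S_exp S_min]].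
pose line : Ubar R := exist _ (-oo, +oo)%E (leNye _).
pose x : Ubar R := exist _ (0%:E, 0%:E)%E (le_refl _).
have lineE : real_itv line = setT.
  by apply/seteqP; split=> y //= _; rewrite /real_itv /= leNye leey.
have xE : real_itv x = [set 0].
  apply/seteqP; split=> y /=; rewrite /real_itv /= !lee_fin -eq_le.
  - by move/eqP.
  - by move=> ->.
have I_line F : pred_intervals alpha F line.
  by rewrite /pred_intervals /= lineE probability_setT lee_fin ltW.
have I_x F : pred_intervals alpha F x = (alpha%:E <= F [set 0%R])%E.
  by rewrite -xE.
have a01 : 0 < alpha < 1 by rewrite alpha_gt0.
have M_dirac (c : R) : M_inc alpha (point_mass c).
  have dc : point_mass c [set y : R | y <= c] = 1%E :> \bar R.
    by rewrite point_massE mem_set //=.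
  apply: (@M_inc_lowest_atom _ _ _ c) => //.
  - by rewrite /left_cdf point_massE memNset //= ltxx.
  - by rewrite dc lte_fin.
  - by rewrite dc lte_fin gtrBl.
have ES_dirac z (c : R) : expected_score S z (point_mass c) = S z c.
  have [[mS _] _] := S_exp z _ (M_dirac c).
  by rewrite /expected_score integral_dirac// diracE mem_set// mul1e.
(* The value [-oo] is excluded by the codomain of [S], and [+oo] by the finite expected score under
   the mass at [c]. *)
have S_fin z (c : R) : S z c \is a fin_num.
  have [_] := S_exp z _ (M_dirac c); rewrite ES_dirac => S_lty.
  by rewrite fin_numE gt_eqF // lt_eqF.
have S0 : S x 0 = S line 0.
  have Ix : pred_intervals alpha (point_mass 0) x.
    by rewrite I_x point_massE mem_set // lee_fin ltW.
  have [le1 _] := S_min x _ _ (M_dirac 0) (I_line _).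
  have [le2 _] := S_min line _ _ (M_dirac 0) Ix.
  by apply/eqP; rewrite -!ES_dirac eq_le le1 le2.
(* Strictness uses the equality clause: a tie would make [x] admissible for the mass at [1],
   although it carries mass [0 < alpha]. *)
have S1 : (S line 1%R < S x 1%R)%E.
  have [le1 ne] := S_min x _ _ (M_dirac 1) (I_line _).
  rewrite -!ES_dirac lt_neqAle le1 andbT; apply/eqP => /ne.
  rewrite I_x point_massE memNset /=; last by move/eqP; rewrite oner_eq0.
  by rewrite lee_fin leNgt alpha_gt0.
(* A midpoint: above [alpha] and [1 - alpha], so that the mixture lies in the class and [x] is
   admissible for it; below [1], so that the atom at [1] keeps positive weight. *)
pose p := (Num.max alpha (1 - alpha) + 1) / 2.
have [p_gta p_gta' p_lt1] : [/\ alpha < p, 1 - alpha < p & p < 1].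
  by rewrite /p; case: (ltrP alpha (1 - alpha)) => h; split; lra.
have p01 : 0 <= p <= 1 by lra.
pose F := two_point p 0 1.
have Fle0 : F [set y : R | y <= 0] = p%:E.
  rewrite /F two_pointE // !diracE mem_set //= memNset /= ?ler10 //.
  by rewrite mule1 mule0 adde0.
have MF : M_inc alpha F.
  apply: (@M_inc_lowest_atom _ _ _ 0) => //; rewrite ?Fle0 //.
  rewrite /left_cdf /F two_pointE // !diracE !memNset /= ?ltxx ?ltr10 //.
  by rewrite !mule0 adde0.
have Ix : pred_intervals alpha F x.
  rewrite I_x /F two_pointE // !diracE mem_set // memNset /=.
    by rewrite mule1 mule0 adde0 lee_fin ltW.
  by move/eqP; rewrite oner_eq0.
have [le_x _] := S_min line _ _ MF Ix.
have ES z : expected_score S z F = (p%:E * S z 0%R + (1 - p)%:E * S z 1%R)%E.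
  have [[mS _] _] := S_exp z _ MF.
  exact: integral_two_point.
(* By [S0] the contributions of the atom at [0] agree and, being finite, cancel; dividing by
   [1 - p > 0] leaves the reverse of [S1]. *)
move: le_x S1; rewrite !ES S0.
rewrite -(fineK (S_fin line 0)) -(fineK (S_fin x 1)) -(fineK (S_fin line 1)).
rewrite -!EFinM -!EFinD lee_fin lte_fin lerD2l ler_pM2l ?subr_gt0 //.
by rewrite ltNge => ->.
Qed.
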